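(* Let $1<q<\infty$ and $q/(q+1)<p<\infty$, and let $r$ be defined by $\frac1p+\frac1r=1+\frac1q$, i.e. $r=\frac{pq}{pq+p-q}$. Then for all $x\in[0,\pi_{r,q}/2)$, $$\sinh_{p,q}x=\frac{\sin_{r,q}x}{\cos_{r,q}^{r/q}x},\qquad \cosh_{p,q}x=\frac{1}{\cos_{r,q}^{r/p}x}.$$
   Context: For $1<q<\infty$ and $q/(q+1)<p<\infty$ (note that $p\le 1$ is allowed): Let $F_{p,q}(y)=\int_0^y \frac{dt}{(1-t^q)^{1/p}}$ for $y\in[0,1)$ and $\pi_{p,q}=2\int_0^1\frac{dt}{(1-t^q)^{1/p}}\in(0,\infty]$, which is finite for $p>1$ and equals $\infty$ for $p\le 1$. The function $\sin_{p,q}:[0,\pi_{p,q}/2)\to[0,1)$ is the inverse of $F_{p,q}$, and $\cos_{p,q}x=\frac{d}{dx}\sin_{p,q}x$ (one-sided derivative at $x=0$). Let $G_{p,q}(y)=\int_0^y \frac{dt}{(1+t^q)^{1/p}}$ for $y\in[0,\infty)$. With $r=r(p)$ defined by $\frac1p+\frac1r=1+\frac1q$ (so that $r>q/(q+1)$ as well), $\sinh_{p,q}:[0,\pi_{r,q}/2)\to[0,\infty)$ is the inverse of $G_{p,q}$ (one has $\lim_{y\to\infty}G_{p,q}(y)=\pi_{r,q}/2$), and $\cosh_{p,q}x=\frac{d}{dx}\sinh_{p,q}x$ (one-sided derivative at $x=0$). The notation $\sin_{p,q}^a x$ means $(\sin_{p,q}x)^a$, and similarly for the other functions. *)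

(* Defs.v *)
From HB Require Import structures.
From mathcomp Require Import all_boot all_order all_algebra.
From mathcomp Require Import all_classical all_reals all_analysis.
Set Implicit Arguments.
Unset Strict Implicit.
Unset Printing Implicit Defensive.
Import Order.TTheory GRing.Theory Num.Theory.
Import numFieldNormedType.Exports.
Local Open Scope classical_set_scope.
Local Open Scope ring_scope.

Section GeneralizedTrigonometric.
Context {R : realType}.
Implicit Types p q x y : R.
Local Notation mu := (@lebesgue_measure R).

Definition arcsin_pq p q y : R :=
  \int[mu]_(t in `[0, y]) ((1 - t `^ q) `^ p^-1)^-1.

(* Extended-real valued, since the integral diverges for p <= 1. *)
Definition pi_pq p q : \bar R :=
  (2%:E * \int[mu]_(t in `[0%R, 1%R[) (((1 - t `^ q) `^ p^-1)^-1)%:E)%E.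

Definition arcsinh_pq p q y : R :=
  \int[mu]_(t in `[0, y]) ((1 + t `^ q) `^ p^-1)^-1.

(* ['pinv_d A f] is the inverse of the restriction of [f] to [A], as a map
   from [f @` A] to [A]; outside [f @` A] it is extended by [d], here 0. *)
Definition sin_pq p q : R -> R :=
  'pinv_(fun=> 0) `[0, 1[%classic (arcsin_pq p q).

Definition sinh_pq p q : R -> R :=
  'pinv_(fun=> 0) `[0, +oo[%classic (arcsinh_pq p q).

(* Derivative of a function on [0, a[: one-sided at 0, where the values of
   the totalized function on negative reals are irrelevant. *)
Definition derive1_from0 (f : R -> R) x : R :=
  if x == 0 then lim (h^-1 *: (f h - f 0) @[h --> 0^'+]) else derive1 f x.

Definition cos_pq p q : R -> R := derive1_from0 (sin_pq p q).

Definition cosh_pq p q : R -> R := derive1_from0 (sinh_pq p q).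

End GeneralizedTrigonometric.

(* Main.v *)
(* Put u(y) = y / (1 - y^q)^(1/q) for 0 <= y < 1.  Then 1 + u^q = (1 - y^q)^-1
   and u' = (1 - y^q)^(-1/q - 1), so the relation between p and r says exactly
   that arcsinh_{p,q} o u and arcsin_{r,q} have the same derivative; both vanish
   at 0, hence they agree.  Writing x = arcsin_{r,q} y, this gives
   sin x = y and sinh x = u(y), and the inverse function theorem gives
   cos x = (1 - y^q)^(1/r) and cosh x = (1 + u(y)^q)^(1/p). *)
Require Import Defs.
From mathcomp Require Import all_boot all_order all_algebra.
From mathcomp Require Import all_classical all_reals all_analysis.
From mathcomp Require Import ring.
Import Order.TTheory GRing.Theory Num.Theory.
Import numFieldNormedType.Exports.
Local Open Scope classical_set_scope.
Local Open Scope ring_scope.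

(** * Continuity of real powers *)

(** The absolute value carries the power continuously across 0, as two-sided derivatives at 0 will
    require. Away from 0 continuity comes from differentiability of powers at positive reals; at 0
    it is checked by hand. *)
Lemma continuous_powR_norm (R : realType) (q : R) : 0 < q ->
  continuous (fun t : R => `|t| `^ q).
Proof.
move=> q0 t; have [->|t0] := eqVneq t 0.
  rewrite /continuous_at normr0 powR0 ?gt_eqF//.
  apply/cvgr0Pnorm_lt => e e0; near=> s.
  (* Since [e = (e^(1/q))^q], it suffices that [|s| < e^(1/q)]. *)
  rewrite ger0_norm ?powR_ge0// -(@powRr1 _ e) ?ltW// -(@mulVf _ q) ?gt_eqF//.
  rewrite powRrM gt0_ltr_powR ?nnegrE ?powR_ge0//.
  by near: s; exact: (@nbhs0_lt R R^o _ (powR_gt0 _ e0)).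
apply: (@continuous_comp _ _ _ (fun t : R => `|t|) (@powR R ^~ q)).
  exact: norm_continuous.
apply/differentiable_continuous/derivable1_diffP/derivable_powR.
by rewrite in_itv/= andbT normr_gt0.
Unshelve. all: by end_near. Qed.

Lemma continuous_powR_pos (R : realType) (s x : R) : 0 < x ->
  {for x, continuous (@powR R ^~ s)}.
Proof.
move=> x0; apply/differentiable_continuous/derivable1_diffP/derivable_powR.
by rewrite in_itv/= andbT.
Qed.

(** * Primitives of continuous functions and derivatives of their inverses *)

Section primitive.
Context {R : realType}.
Notation mu := (@lebesgue_measure R).
Implicit Types (w : R -> R) (a b y z : R).

(** Integrating from a negative [a] makes 0 an interior point, so the fundamental theorem of
    calculus gives a two-sided derivative there. The second term normalizes the value at 0 to 0. *)
Definition primitive a w z : R :=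
  \int[mu]_(t in `[a, z]) w t - \int[mu]_(t in `[a, 0]) w t.

Lemma primitive0 a w : primitive a w 0 = 0.
Proof. exact: subrr. Qed.

Lemma continuous_itv_integrable w a b : {in `[a, b], continuous w} ->
  mu.-integrable `[a, b] (EFin \o w).
Proof.
move=> cw; apply: continuous_compact_integrable; first exact: segment_compact.
by apply: continuous_in_subspaceT => z; rewrite inE/= => zab; exact: cw.
Qed.

Lemma is_derive_primitive w a b z : {in `[a, b], continuous w} ->
  a < z < b -> is_derive z 1 (primitive a w) (w z).
Proof.
move=> cw /andP[az zb].
have [||d1 d2] := @continuous_FTC1_closed R w a z b zb _ az.
- exact: continuous_itv_integrable.
- by apply: cw; rewrite in_itv/= (ltW az) (ltW zb).
have H : is_derive z 1 (fun x => \int[mu]_(t in `[a, x]) w t) (w z).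
  exact: (DeriveDef d1 (etrans (esym (derive1E _ _)) d2)).
rewrite -[w z]subr0.
exact: (is_deriveB H).
Qed.

Lemma primitive_Rintegral w a z : a < 0 -> 0 <= z ->
  {in `[a, z], continuous w} ->
  primitive a w z = \int[mu]_(t in `[0, z]) w t.
Proof.
move=> a0 z0 cw; have iw := continuous_itv_integrable _ _ _ cw.
rewrite /primitive Rintegral_itvB ?bnd_simp ?(ltW a0)//.
rewrite Rintegral_itv_obnd_cbnd//.
apply: integrableS iw => //.
by apply: subset_itvr; rewrite bnd_simp ltW.
Qed.

(* Extending the inverse to the left of [0] makes the one-sided derivative at
   [0] an instance of the two-sided inverse function theorem. *)
Lemma derive1_from0_inverse (F g w : R -> R) a b y :
    a < 0 -> 0 <= y < b ->
    (forall z, z \in `]a, b[ -> is_derive z 1 F (w z)) ->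
    (forall z, z \in `]a, b[ -> 0 < w z) ->
    F 0 = 0 -> (forall z, 0 <= z < b -> g (F z) = z) ->
  derive1_from0 g (F y) = (w y)^-1.
Proof.
move=> a0 /andP[y0 yb] dF w0 F0 gK.
have dF1 z : z \in `]a, b[ -> derivable F z 1.
  by move=> /dF[].
have cF : {in `]a, b[, continuous F}.
  by move=> z /dF1 /derivable1_diffP /differentiable_continuous.
have incF : {in `]a, b[ &, {homo F : x y / x < y}}.
  apply: gtr0_derive1_lt_oo => [//| z zab|z].
    by rewrite derive1E; have [_ ->] := dF _ zab; exact: w0.
  by rewrite inE; exact: cF.
have yab : y \in `]a, b[ by rewrite in_itv/= yb (lt_le_trans a0).
have oab : 0 \in `]a, b[ by rewrite in_itv/= a0 (le_lt_trans y0).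
have cFy : {near y, continuous F}.
  by near=> z; apply: cF; near: z; exact: near_in_itvoo.
have wy : w y != 0 by rewrite gt_eqF ?w0.
(* For [y > 0] also [F y > 0], so the ordinary derivative is meant and the inverse function theorem
   applies to [g] directly. *)
rewrite /derive1_from0; have [y00|y00] := eqVneq y 0; last first.
  have y_gt0 : 0 < y by rewrite lt_def y00.
  rewrite gt_eqF; last by rewrite -F0 incF.
  have gd : is_derive (F y) 1 g (w y)^-1.
    apply: is_derive_inverse => //; last exact: dF.
    near=> z; apply: gK.
    have : z \in `]0, b[.
      by near: z; apply: near_in_itvoo; rewrite in_itv/= y_gt0.
    by rewrite in_itv/= => /andP[/ltW -> ->].
  by rewrite derive1E; case: gd.
(* At [y = 0] nothing is known of [g] on the left. The inverse [G] of [F] on all of []a, b[] is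
   differentiable at 0, and [g] agrees with it just to the right. *)
subst y; rewrite F0 eqxx.
have iF : {in `]a, b[%classic &, injective F}.
  move=> u v; rewrite !inE/= => uab vab Fuv.
  case: (ltgtP u v) => // uv.
    by have := incF _ _ uab vab uv; rewrite Fuv ltxx.
  by have := incF _ _ vab uab uv; rewrite Fuv ltxx.
pose G : R -> R := 'pinv_(fun=> 0) `]a, b[%classic F.
have GK z : z \in `]a, b[ -> G (F z) = z.
  by move=> zab; apply: pinvKV => //; rewrite inE.
have [dG GE] : is_derive (F 0) 1 G (w 0)^-1.
  apply: is_derive_inverse => //; last exact: dF.
  by near=> z; apply: GK; near: z; exact: near_in_itvoo.
apply/cvg_lim => //.
move: dG; rewrite /derivable -/('D_1 G (F 0)) GE F0 => dG.
(* By the intermediate value theorem [h = F c] with [0 <= c <= b / 2], and both inverses send [h] to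
   [c]. The midpoint is used because [b] itself lies outside the domain. *)
have gG : forall h, 0 <= h -> h <= F (b / 2) -> g h = G h.
  move=> h h0 hb; have b0 : 0 < b by move: oab; rewrite in_itv/= => /andP[].
  have b2 : 0 <= b / 2 by rewrite divr_ge0 ?ltW.
  have b2b : b / 2 < b by rewrite ltr_pdivrMr// ltr_pMr// ltr1n.
  have [||c] := @IVT _ F 0 (b / 2) h b2.
  - apply: continuous_in_subspaceT => z; rewrite inE/= in_itv/= => /andP[z0 zb].
    by apply: cF; rewrite in_itv/= (lt_le_trans a0)// (le_lt_trans zb).
  - have : F 0 <= F (b / 2).
      rewrite ltW// incF ?divr_gt0// in_itv/= b2b andbT.
      by rewrite (lt_le_trans a0).
    by move=> /[dup] /min_idPl -> /max_idPr ->; rewrite F0 h0.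
  rewrite in_itv/= => /andP[c0 cb] <-.
  rewrite gK ?c0 ?(le_lt_trans cb)// GK// in_itv/= (lt_le_trans a0)//=.
  exact: le_lt_trans b2b.
have Fb2 : 0 < F (b / 2).
  rewrite -[ltLHS]F0 incF ?divr_gt0// in_itv/= (lt_trans a0) ?divr_gt0//.
  by rewrite ltr_pdivrMr// ltr_pMr// ltr1n.
(* The two-sided limit for [G] restricts to the right, where its difference quotients are those of
   [g]. *)
apply: cvg_trans (cvg_dnbhs_at_right dG); apply: near_eq_cvg; near=> h.
rewrite /= addr0 (_ : h%:A = h); last exact: mulr1.
rewrite -(gG h) -?(gG 0) ?lexx ?(ltW Fb2)//.
by near: h; exact: nbhs_right_ltW.
Unshelve. all: by end_near. Qed.

(** * Integral functions on a symmetric open interval: monotonicity, range and inverse *)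

Section symmetric_domain.
Variables (w : R -> R) (b : R).
Hypothesis b0 : 0 < b.
Hypothesis cw : {in `]-b, b[, continuous w}.
Let J z := \int[mu]_(t in `[0, z]) w t.
(** This extends [J] to the left of 0. Continuity of [w] is known only inside []-b, b[], so the base
    point is kept strictly inside. *)
Let F := primitive (- (b / 2)) w.

Let b2b : b / 2 < b.
Proof. by rewrite ltr_pdivrMr// ltr_pMr// ltr1n. Qed.

Let Nb2_lt0 : - (b / 2) < 0.
Proof. by rewrite oppr_lt0 divr_gt0. Qed.

Let cwS u : u < b -> {in `[- (b / 2), u], continuous w}.
Proof.
move=> ub z; rewrite in_itv/= => /andP[z1 z2]; apply: cw.
by rewrite in_itv/= (le_lt_trans z2)// andbT (lt_le_trans _ z1)// ltrN2.
Qed.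

Let dF z : z \in `]- (b / 2), b[ -> is_derive z 1 F (w z).
Proof.
rewrite in_itv/= => /andP[bz zb].
(* The midpoint of [z] and [b] leaves room to the right of [z] while staying below [b]. *)
apply: (@is_derive_primitive _ _ ((z + b) / 2)); last by rewrite bz midf_lt.
by apply: cwS; rewrite midf_lt.
Qed.

Let FE z : 0 <= z < b -> F z = J z.
Proof.
by move=> /andP[z0 zb]; apply: primitive_Rintegral => //; exact: cwS.
Qed.

Lemma integrable_ge0_itv z : z < b -> mu.-integrable `[0, z] (EFin \o w).
Proof.
move=> zb; apply: continuous_itv_integrable => y.
rewrite in_itv/= => /andP[y0 yz]; apply: cw.
by rewrite in_itv/= (le_lt_trans yz)// andbT (lt_le_trans _ y0)// oppr_lt0.
Qed.

Lemma is_derive_Rintegral z : 0 < z < b -> is_derive z 1 J (w z).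
Proof.
move=> /andP[z0 zb]; apply: near_eq_is_derive (dF _ _); last first.
  by rewrite in_itv/= zb (lt_trans Nb2_lt0).
near=> y; apply: FE.
have : y \in `]0, b[ by near: y; apply: near_in_itvoo; rewrite in_itv/= z0.
by rewrite in_itv/= => /andP[/ltW -> ->].
Unshelve. all: by end_near. Qed.

Lemma within_continuous_Rintegral z : z < b -> {within `[0, z], continuous J}.
Proof.
move=> zb; apply: (@subspace_eq_continuous _ _ _ F).
  move=> y; rewrite inE/= in_itv/= => /andP[y0 yz]; apply: FE.
  by rewrite y0 (le_lt_trans yz).
apply: continuous_in_subspaceT => y; rewrite inE/= in_itv/= => /andP[y0 yz].
apply/differentiable_continuous/derivable1_diffP.
have [] // := dF y _; rewrite in_itv/= (le_lt_trans yz)// andbT.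
exact: lt_le_trans y0.
Qed.

Hypothesis w_gt0 : forall z, z \in `]-b, b[ -> 0 < w z.

Lemma ltr_Rintegral y z : 0 <= y -> y < z -> z < b -> J y < J z.
Proof.
move=> y0 yz zb; have z0 := le_lt_trans y0 yz.
have [||c] := @MVT _ J w y z yz.
- move=> c; rewrite in_itv/= => /andP[yc cz].
  by apply: is_derive_Rintegral; rewrite (le_lt_trans y0 yc) (lt_trans cz).
- apply: continuous_subspaceW (within_continuous_Rintegral _ zb).
  exact: subset_itvr.
- rewrite in_itv/= -subr_gt0 => /andP[yc cz] ->; rewrite mulr_gt0 ?subr_gt0//.
  apply: w_gt0; rewrite in_itv/= (lt_trans cz)// andbT.
  by rewrite (lt_trans _ yc)// (lt_le_trans _ y0)// oppr_lt0.
Qed.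

Lemma Rintegral_inj y z : 0 <= y < b -> 0 <= z < b -> J y = J z -> y = z.
Proof.
move=> /andP[y0 yb] /andP[z0 zb]; case: (ltgtP y z) => // yz Jyz.
  by have := ltr_Rintegral _ _ y0 yz zb; rewrite Jyz ltxx.
by have := ltr_Rintegral _ _ z0 yz yb; rewrite Jyz ltxx.
Qed.

Lemma Rintegral_surj (x z : R) : 0 <= z < b -> 0 <= x <= J z ->
  exists2 y, 0 <= y <= z & J y = x.
Proof.
move=> /andP[z0 zb] /andP[x0 xz].
have J0 : J 0 = 0 by rewrite /J set_itv1 Rintegral_set1.
have Jz : 0 <= J z by exact: le_trans xz.
have [||y] := @IVT _ J 0 z x z0.
- exact: within_continuous_Rintegral.
- by rewrite J0 (min_idPl Jz) (max_idPr Jz) x0.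
- by rewrite in_itv/= => yz Jyx; exists y.
Qed.

(** Exhaust [[0, b[] by closed intervals [[0, u n]]. If one of their integrals reaches [x], the
    intermediate value theorem applies there; otherwise monotone convergence bounds the full
    integral by [x]. The full integral may be infinite. *)
Lemma lt_integral_surj (x : R) : 0 <= x ->
  (x%:E < \int[mu]_(t in `[0%R, b[) (w t)%:E)%E ->
  exists2 y, 0 <= y < b & J y = x.
Proof.
move=> x0 xI.
pose u n : R := b * (1 - n.+1%:R^-1).
have u_b n : u n < b by rewrite /u gtr_pMr// ltrBlDr ltrDl.
have u_ge0 n : 0 <= u n.
  by rewrite mulr_ge0 ?subr_ge0 ?invf_le1 ?ler1n// ltW.
suff [n xn] : exists n, (x%:E <= \int[mu]_(t in `[0%R, u n]) (w t)%:E)%E.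
  have [||y /andP[y0 yu] <-] := @Rintegral_surj x (u n).
    - by rewrite u_ge0 u_b.
    - rewrite x0 -lee_fin /J /Rintegral fineK//.
      exact/integrable_fin_num/integrable_ge0_itv.
    - by exists y => //; rewrite y0 (le_lt_trans yu).
apply: contrapT => /forallNP xn; move: xI; rewrite ltNge => /negP; apply.
have -> : `[0, b[%classic = \bigcup_n `[0, u n]%classic.
  apply/seteqP; split => [z|z [n _]]; rewrite /= !in_itv/= => /andP[z0 zb].
    (* The inequality [z <= b * (1 - 1/(n+1))] amounts to [b / (b - z) <= n + 1]. *)
    have [n] : exists n : nat, b / (b - z) < n.+1%:R.
      by exists (Num.truncn (b / (b - z))); exact: truncnS_gt.
    rewrite ltr_pdivrMr ?subr_gt0// => nz.
    exists n => //=; rewrite in_itv/= z0/= /u mulrBr mulr1 lerBrDl -lerBrDr.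
    by rewrite ler_pdivrMr// mulrC ltW.
  by rewrite z0 (le_lt_trans zb).
have cvI := @ge0_nondecreasing_set_cvg_integral _ (measurableTypeR R) R
  (fun n => `[0, u n]%classic) (EFin \o w) mu.
apply: (cvge_to_le (cvI _ _ _ _)) => //=; last 1 first.
- by apply: nearW => n; rewrite leNgt; apply/negP => /ltW; exact: xn.
- move=> m n mn; rewrite subsetEset; apply: subset_itvl; rewrite bnd_simp.
    by rewrite ler_pM2l// lerD2l lerN2 lef_pV2 ?posrE// ler_nat.
  - by move=> n; apply: measurable_int; exact: integrable_ge0_itv.
  - move=> n z /=; rewrite in_itv/= => /andP[z0 zn].
    rewrite lee_fin ltW// w_gt0//.
    by rewrite in_itv/= (le_lt_trans zn)// andbT (lt_le_trans _ z0)// oppr_lt0.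
Qed.

Lemma derive1_from0_pinv_Rintegral (g : R -> R) y : 0 <= y < b ->
  (forall z, 0 <= z < b -> g (J z) = z) -> derive1_from0 g (J y) = (w y)^-1.
Proof.
move=> yb gK; rewrite -FE//.
apply: (@derive1_from0_inverse _ _ _ _ b _ Nb2_lt0) => //.
- move=> z; rewrite in_itv/= => /andP[bz zb]; apply: w_gt0.
  by rewrite in_itv/= zb andbT (lt_trans _ bz)// ltrN2.
- exact: primitive0.
- by move=> z zb; rewrite FE// gK.
Qed.
End symmetric_domain.
End primitive.

(** * The generalized sine and hyperbolic sine as inverses, and their derivatives *)

Section generalized_trigonometric.
Context {R : realType}.
Notation mu := (@lebesgue_measure R).
Implicit Types p q r y z : R.

(* The integrands are extended evenly, since [t `^ q = 1] for [t < 0]. *)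
Let sin_w r q (t : R) : R := ((1 - `|t| `^ q) `^ r^-1)^-1.
Let sinh_w p q (t : R) : R := ((1 + `|t| `^ q) `^ p^-1)^-1.

Let arcsin_pqE r q y : arcsin_pq r q y = \int[mu]_(t in `[0, y]) sin_w r q t.
Proof.
apply: eq_Rintegral => t; rewrite inE/= in_itv/= => /andP[t0 _].
by rewrite /sin_w ger0_norm.
Qed.

Let arcsinh_pqE p q y : arcsinh_pq p q y = \int[mu]_(t in `[0, y]) sinh_w p q t.
Proof.
apply: eq_Rintegral => t; rewrite inE/= in_itv/= => /andP[t0 _].
by rewrite /sinh_w ger0_norm.
Qed.

Lemma subr1_powR_norm_gt0 q z : 0 < q -> z \in `]-1, 1[ -> 0 < 1 - `|z| `^ q.
Proof.
move=> q0; rewrite in_itv/= -ltr_norml => z1.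
have := gt0_ltr_powR q0 (normr_ge0 z : `|z| \in Num.nneg)
  (ler01 : 1 \in Num.nneg) z1.
by rewrite powR1 subr_gt0.
Qed.

Lemma subr1_powR_gt0 q z : 0 < q -> 0 <= z < 1 -> 0 < 1 - z `^ q.
Proof.
move=> q0 /andP[z0 z1]; rewrite -(ger0_norm z0) subr1_powR_norm_gt0// in_itv/=.
by rewrite z1 (lt_le_trans _ z0)// oppr_lt0.
Qed.

Lemma addr1_powR_norm_gt0 q z : 0 < 1 + `|z| `^ q.
Proof. by rewrite (lt_le_trans ltr01)// lerDl powR_ge0. Qed.

Let sin_w_gt0 r q : 0 < q -> forall z, z \in `]-1, 1[ -> 0 < sin_w r q z.
Proof.
by move=> q0 z z1; rewrite /sin_w invr_gt0 powR_gt0// subr1_powR_norm_gt0.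
Qed.

Let sinh_w_gt0 p q z : 0 < sinh_w p q z.
Proof. by rewrite /sinh_w invr_gt0 powR_gt0// addr1_powR_norm_gt0. Qed.

Lemma continuous_subr1_powR_norm q s z : 0 < q -> z \in `]-1, 1[ ->
  {for z, continuous (fun t : R => (1 - `|t| `^ q) `^ s)}.
Proof.
move=> q0 z1.
apply: (@continuous_comp _ _ _ (fun t : R => 1 - `|t| `^ q) (@powR R ^~ s)).
  apply: continuousB; first exact: cst_continuous.
  exact: continuous_powR_norm.
exact/continuous_powR_pos/subr1_powR_norm_gt0.
Qed.

Let continuous_sin_w r q : 0 < q -> {in `]-1, 1[, continuous (sin_w r q)}.
Proof.
move=> q0 z z1.
apply: (@cvgV _ _ _ _ (fun t : R => (1 - `|t| `^ q) `^ r^-1)); last first.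
  exact: continuous_subr1_powR_norm.
by rewrite gt_eqF// powR_gt0 ?subr1_powR_norm_gt0.
Qed.

Let continuous_sinh_w p q : 0 < q -> continuous (sinh_w p q).
Proof.
move=> q0 z; apply: (@cvgV _ _ _ _ (fun t : R => (1 + `|t| `^ q) `^ p^-1)).
  by rewrite gt_eqF// powR_gt0 ?addr1_powR_norm_gt0.
apply: (@continuous_comp _ _ _ (fun t : R => 1 + `|t| `^ q) (@powR R ^~ p^-1)).
  apply: continuousD; first exact: cst_continuous.
  exact: continuous_powR_norm.
exact/continuous_powR_pos/addr1_powR_norm_gt0.
Qed.

Lemma sin_pqK r q y : 0 < q -> 0 <= y < 1 -> sin_pq r q (arcsin_pq r q y) = y.
Proof.
move=> q0 y1; apply: pinvKV; last by rewrite inE/= in_itv.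
move=> u v; rewrite !inE/= !in_itv/= => u1 v1; rewrite !arcsin_pqE.
exact: (Rintegral_inj _ _ ltr01 (continuous_sin_w _ _ q0) (sin_w_gt0 _ _ q0)).
Qed.

Lemma sinh_pqK p q y : 0 < q -> 0 <= y -> sinh_pq p q (arcsinh_pq p q y) = y.
Proof.
move=> q0 y0; apply: pinvKV; last by rewrite inE/= in_itv/= y0.
move=> u v; rewrite !inE/= !in_itv/= !andbT => u0 v0; rewrite !arcsinh_pqE.
(* The integrand is continuous and positive on the whole line; any finite bound beyond both points
   gives a suitable symmetric interval. *)
have m0 : 0 < Num.max u v + 1 by rewrite ltr_wpDl// le_max u0.
apply: (Rintegral_inj _ _ m0).
- by move=> z _; exact: continuous_sinh_w.
- by move=> z _; exact: sinh_w_gt0.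
- by rewrite u0/= ltr_pwDr// le_max lexx.
- by rewrite v0/= ltr_pwDr// le_max lexx orbT.
Qed.

Lemma cos_pq_arcsin r q y : 0 < q -> 0 <= y < 1 ->
  cos_pq r q (arcsin_pq r q y) = (1 - y `^ q) `^ r^-1.
Proof.
move=> q0 y1; rewrite arcsin_pqE /cos_pq.
rewrite (derive1_from0_pinv_Rintegral _ _ ltr01 (continuous_sin_w _ _ q0)) //.
- by rewrite invrK ger0_norm//; case/andP: y1.
- exact: sin_w_gt0.
- by move=> z z1; rewrite -arcsin_pqE sin_pqK.
Qed.

Lemma cosh_pq_arcsinh p q y : 0 < q -> 0 <= y ->
  cosh_pq p q (arcsinh_pq p q y) = (1 + y `^ q) `^ p^-1.
Proof.
move=> q0 y0; rewrite arcsinh_pqE /cosh_pq.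
rewrite (@derive1_from0_pinv_Rintegral _ _ (y + 1)).
- by rewrite invrK ger0_norm.
- by rewrite ltr_wpDl.
- by move=> z _; exact: continuous_sinh_w.
- by move=> z _; exact: sinh_w_gt0.
- by rewrite y0 ltrDl ltr01.
- by move=> z /andP[z0 _]; rewrite -arcsinh_pqE sinh_pqK.
Qed.

Lemma arcsin_pq_surj r q x : 0 < q -> 0 <= x ->
  (x%:E < pi_pq r q * (2^-1)%:E)%E ->
  exists2 y, 0 <= y < 1 & arcsin_pq r q y = x.
Proof.
(* The factors 2 and 1/2 cancel in the extended reals even when the integral is infinite. *)
move=> q0 x0; rewrite /pi_pq muleAC -EFinM mulfV// mul1e.
have -> : (\int[mu]_(t in `[0%R, 1%R[) (((1 - t `^ q) `^ r^-1)^-1)%:E =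
    \int[mu]_(t in `[0%R, 1%R[) (sin_w r q t)%:E)%E.
  apply: eq_integral => t; rewrite inE/= in_itv/= => /andP[t0 _].
  by rewrite /sin_w ger0_norm.
move=> /(lt_integral_surj _ _ ltr01 (continuous_sin_w _ _ q0)
  (sin_w_gt0 _ _ q0) _ x0)[y y1 <-].
by exists y => //; rewrite arcsin_pqE.
Qed.

(** * The substitution linking the two integrals *)

(** This is the [u] of the overview, a generalized tangent, extended to an odd function so that it
    is continuous at 0. *)
Let tan_w q (t : R) : R := t * (1 - `|t| `^ q) `^ (- q^-1).

(** With [v = 1 - z^q], the product rule gives [v^(-1/q) + z^q * v^(-1/q - 1) = v^(-1/q - 1) * (v +
    z^q)], and [v + z^q = 1]. *)
Let is_derive_tan_w q z : 0 < q -> 0 < z < 1 ->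
  is_derive z 1 (tan_w q) ((1 - z `^ q) `^ (- q^-1 - 1)).
Proof.
move=> q0 /andP[z0 z1].
have v0 : 0 < 1 - z `^ q by rewrite subr1_powR_gt0// ltW.
apply: (@near_eq_is_derive _ R^o R^o
  (fun t : R => t * (1 - t `^ q) `^ (- q^-1))).
  by near=> t; rewrite /tan_w gtr0_norm//; near: t; exact: lt_nbhsr.
have d1 : is_derive z 1 (fun t : R => 1 - t `^ q) (0 - q * z `^ (q - 1)).
  by apply: is_deriveB; exact: is_derive1_powR.
have d2 := @is_derive1_comp _ (@powR R ^~ (- q^-1)) (fun t : R => 1 - t `^ q)
  _ _ _ (is_derive1_powR (- q^-1) v0) d1.
apply: is_derive_eq (is_deriveM (is_derive_id z 1) d2) _.
have q_neq0 : q != 0 by rewrite gt_eqF.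
have vE : (1 - z `^ q) `^ (- q^-1) =
    (1 - z `^ q) `^ (- q^-1 - 1) * (1 - z `^ q).
  rewrite -[X in _ = _ * X]powRr1 ?ltW// -powRD ?subrK//.
  by apply/implyP => _; rewrite gt_eqF.
(* With the common power abstracted and [z^q] written as [z * z^(q-1)], a rational identity
   remains. *)
rewrite /= sub0r vE /GRing.scale/=; move: (_ `^ (- q^-1 - 1)) => k.
rewrite -[X in 1 - X](mulr_powRB1 (ltW z0) q0).
by field.
Unshelve. all: by end_near. Qed.

Let continuous_tan_w q : 0 < q -> {in `]-1, 1[, continuous (tan_w q)}.
Proof.
move=> q0 z z1; apply: (@cvgM _ _ _ _ id); first exact: cvg_id.
exact: continuous_subr1_powR_norm.
Qed.

(** With [v = 1 - z^q], the left side is [1 + z^q / v = (v + z^q) / v]. *)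
Lemma tan_powR q z : 0 < q -> 0 <= z < 1 ->
  1 + (z / (1 - z `^ q) `^ q^-1) `^ q = (1 - z `^ q)^-1.
Proof.
move=> q0 z01; have /andP[z0 _] := z01.
have v0 := subr1_powR_gt0 _ _ q0 z01.
rewrite powRM ?invr_ge0 ?powR_ge0//.
rewrite -powRN -powRrM mulNr mulVf ?gt_eqF// powR_inv1 ?ltW//.
by field; rewrite gt_eqF.
Qed.

Lemma arcsinh_tan p q r y : 0 < q -> p^-1 + r^-1 = 1 + q^-1 -> 0 <= y < 1 ->
  arcsinh_pq p q (y / (1 - y `^ q) `^ q^-1) = arcsin_pq r q y.
Proof.
move=> q0 pqr /andP[y0 y1].
have -> : y / (1 - y `^ q) `^ q^-1 = tan_w q y.
  by rewrite /tan_w ger0_norm// powRN.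
have tan_ge0 (t : R) : 0 <= t -> 0 <= tan_w q t.
  by move=> t0; rewrite mulr_ge0 ?powR_ge0.
have N1 : -1 < 0 :> R by rewrite oppr_lt0.
have N2 : -1 < - (2^-1) :> R by rewrite ltrN2 invf_lt1// ltr1n.
have N20 : - (2^-1) < 0 :> R by rewrite oppr_lt0 invr_gt0.
(* The base point of [S] must lie inside []-1, 1[]; for [T], whose integrand is continuous
   everywhere, -1 serves. *)
pose S := primitive (- (2^-1)) (sin_w r q).
pose T := primitive (-1) (sinh_w p q).
have dS (t : R) : 0 <= t <= y -> is_derive t 1 S (sin_w r q t).
  move=> /andP[t0 ty]; apply: (@is_derive_primitive _ _ _ ((t + 1) / 2)).
    move=> z; rewrite in_itv/= => /andP[z0 z1]; apply: continuous_sin_w => //.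
    rewrite in_itv/= (lt_le_trans N2 z0) (le_lt_trans z1)// midf_lt//.
    exact: le_lt_trans y1.
  by rewrite (lt_le_trans N20 t0) midf_lt// (le_lt_trans ty).
have dT (t : R) : 0 <= t -> is_derive t 1 T (sinh_w p q t).
  move=> t0; apply: (@is_derive_primitive _ _ _ (t + 1)).
    by move=> z _; exact: continuous_sinh_w.
  by rewrite (lt_le_trans N1 t0) ltrDl ltr01.
have <- : T (tan_w q y) = arcsinh_pq p q (tan_w q y).
  rewrite arcsinh_pqE; apply: primitive_Rintegral => //; first exact: tan_ge0.
  by move=> z _; exact: continuous_sinh_w.
have <- : S y = arcsin_pq r q y.
  rewrite arcsin_pqE; apply: primitive_Rintegral => // z.
  rewrite in_itv/= => /andP[z0 zy]; apply: continuous_sin_w => //.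
  by rewrite in_itv/= (lt_le_trans N2 z0) (le_lt_trans zy).
pose H t := T (tan_w q t) - S t.
(* The chain rule is applied on the open interval; continuity of [H] takes care of the endpoints. *)
have dH (t : R) : t \in `]0, y[ -> is_derive t 1 H 0.
  rewrite in_itv/= => /andP[t0 ty]; have t1 := lt_trans ty y1.
  have d1 := is_derive1_comp (dT _ (tan_ge0 _ (ltW t0)))
    (is_derive_tan_w q t q0 ltac:(by rewrite t0 t1)).
  have d2 : is_derive t 1 S (sin_w r q t) by apply: dS; rewrite !ltW.
  apply: is_derive_eq (is_deriveB d1 d2) _; apply/eqP; rewrite subr_eq0.
  apply/eqP; have v0 : 0 < 1 - t `^ q by rewrite subr1_powR_gt0// ltW.
  rewrite /sinh_w /sin_w ger0_norm ?tan_ge0 1?ltW// gtr0_norm//.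
  rewrite {1}/tan_w gtr0_norm// powRN tan_powR ?(ltW t0)//.
  rewrite -[(1 - t `^ q)^-1]powR_inv1 ?ltW// -powRrM mulN1r -!powRN opprK.
  rewrite -powRD; last first.
    by apply/implyP => _; rewrite gt_eqF.
  (* Here the relation between the parameters enters: [1/p - 1/q - 1 = -1/r]. *)
  by rewrite -opprD (addrC q^-1) -pqr opprD addrA subrr add0r.
have cH : {within `[0, y], continuous H}.
  apply: continuous_in_subspaceT => t; rewrite inE/= in_itv/= => /andP[t0 ty].
  apply: (@cvgB _ _ _ _ _ (T \o tan_w q) S); last first.
    apply/differentiable_continuous/derivable1_diffP.
    by have [] // := dS t; rewrite t0.
  apply: (@continuous_comp _ _ _ (tan_w q) T).
    apply: continuous_tan_w => //.
    by rewrite in_itv/= (lt_le_trans N1 t0) (le_lt_trans ty).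
  apply/differentiable_continuous/derivable1_diffP.
  by have [] := dT _ (tan_ge0 _ t0).
have [c _] := MVT_segment y0 dH cH.
rewrite mul0r /H [tan_w q 0]mul0r /T /S !primitive0 !subr0.
by move/eqP; rewrite subr_eq0 => /eqP.
Qed.

End generalized_trigonometric.

(** * Both identities, read off at [x = arcsin_pq r q y] *)

Theorem lemma1p1 (R : realType) (p q r : R) (hq : 1 < q) (hp : q / (q + 1) < p)
    (hr : p^-1 + r^-1 = 1 + q^-1) (x : R) (hx0 : 0 <= x)
    (hx : (x%:E < pi_pq r q * (2^-1)%:E)%E) :
  sinh_pq p q x = sin_pq r q x / (cos_pq r q x `^ (r / q)) /\
  cosh_pq p q x = 1 / (cos_pq r q x `^ (r / p)).
Proof.
have q0 : 0 < q := lt_trans ltr01 hq.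
(* As the inverse of 0 is 0 by convention, [r = 0] would give [1/p = 1 + 1/q], that is
   [p = q/(q+1)], contradicting [hp]. *)
have r0 : r != 0.
  apply: contraTneq hp => r0; move: hr; rewrite r0 invr0 addr0 => pE.
  have q10 : q + 1 != 0 by rewrite gt_eqF// addr_gt0.
  rewrite -[p]invrK pE -leNgt (_ : (1 + q^-1)^-1 = q / (q + 1))//.
  by field; rewrite q10 gt_eqF.
have [y y1 <-] := arcsin_pq_surj _ _ _ q0 hx0 hx.
have v0 := ltW (subr1_powR_gt0 _ _ q0 y1).
have u0 : 0 <= y / (1 - y `^ q) `^ q^-1.
  by rewrite divr_ge0 ?powR_ge0//; case/andP: y1.
(* With [v = 1 - y^q], the powers of the cosine become [(v^(1/r))^(r/q) = v^(1/q)] and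
   [(v^(1/r))^(r/p) = v^(1/p)]. *)
rewrite sin_pqK// cos_pq_arcsin// -!powRrM !(mulrA r^-1) mulVf// !mul1r.
rewrite -(arcsinh_tan _ _ _ _ q0 hr y1) sinh_pqK// cosh_pq_arcsinh//.
rewrite tan_powR//; split => //.
by rewrite -[X in X `^ _]powR_inv1 -?powRrM ?mulN1r ?powRN.
Qed.
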